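(* Let $X$ be a Hadamard space with linear dual space $X^{\lozenge}$, let $p\in X$, and let $T:X\multimap X^{\lozenge}$ be a set-valued operator. (i) Let $a,b\in X$ be such that $\{a,b\}\times\mathrm{Range}(T)$ has the $\mathcal F_l$-property. Then for all $a^{\lozenge},b^{\lozenge}\in X^{\lozenge}$ and $\lambda\in[0,1]$, $$\Phi^p_T(c(\lambda),c^{\lozenge}(\lambda))\le(1-\lambda)\Phi^p_T(a,a^{\lozenge})+\lambda\Phi^p_T(b,b^{\lozenge}),$$ where $c(\lambda):=(1-\lambda)a\oplus\lambda b$ and $c^{\lozenge}(\lambda):=(1-\lambda)a^{\lozenge}+\lambda b^{\lozenge}$. (ii) Let $C\subseteq X\times X^{\lozenge}$ be a convex set with the $\mathcal F_l$-property and $\mathrm{Range}(T)\subseteq\mathrm{Range}(C)$. Then $\Phi^p_T+\iota_C$ is convex. (iii) $\Phi^p_T$ is convex if $X\times\mathrm{Range}(T)$ has the $\mathcal F_l$-property. (iv) $\Phi^p_T$ is convex if $X$ is a flat Hadamard space.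
   Context: A Hadamard space is a (nonempty) complete $\mathrm{CAT}(0)$ space $(X,d)$. For $x,y\in X$ and $t\in[0,1]$, $(1-t)x\oplus ty$ denotes the point $c(t)$ of the unique constant-speed geodesic $c:[0,1]\to X$ from $x$ to $y$. $X$ is flat if $d(z,(1-t)x\oplus ty)^2=(1-t)d(z,x)^2+td(z,y)^2-t(1-t)d(x,y)^2$ for all $x,y,z\in X$, $t\in[0,1]$. Quasilinearization: for $x,y,u,v\in X$, $\langle\overrightarrow{xy},\overrightarrow{uv}\rangle:=\frac12\big(d(x,v)^2+d(y,u)^2-d(x,u)^2-d(y,v)^2\big)$. Dual spaces: for $t\in\mathbb R$, $a,b\in X$, $[t\overrightarrow{ab}]$ is the class of $(t,a,b)\in\mathbb R\times X^2$ under the relation $(t,a,b)\sim(s,c,d)$ iff $t\langle\overrightarrow{ab},\overrightarrow{xy}\rangle=s\langle\overrightarrow{cd},\overrightarrow{xy}\rangle$ for all $x,y\in X$; it is identified with the function $\overrightarrow{xy}\mapsto t\langle\overrightarrow{ab},\overrightarrow{xy}\rangle$ on $X^2$. $X^*$ is the set of all such classes, and the linear dual $X^{\lozenge}$ is the real vector space of all finite linear combinations $\sum_i\alpha_i x_i^*$ ($\alpha_i\in\mathbb R$, $x_i^*\in X^*$), acting on $X^2$ by $\langle\sum_i\alpha_ix_i^*,\overrightarrow{xy}\rangle=\sum_i\alpha_i\langle x_i^*,\overrightarrow{xy}\rangle$ (elements with the same action are equal). For $M\subseteq X\times X^{\lozenge}$: $\mathrm{Dom}(M)$ and $\mathrm{Range}(M)$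 are the projections of $M$ to $X$ and $X^{\lozenge}$. $M$ has the $\mathcal F_l$-property if $\langle x^{\lozenge},\overrightarrow{p((1-\lambda)x\oplus\lambda y)}\rangle\le(1-\lambda)\langle x^{\lozenge},\overrightarrow{px}\rangle+\lambda\langle x^{\lozenge},\overrightarrow{py}\rangle$ for all $\lambda\in[0,1]$, $x^{\lozenge}\in\mathrm{Range}(M)$, $x,y\in\mathrm{Dom}(M)$ (this does not depend on the choice of $p\in X$). A set $C\subseteq X\times X^{\lozenge}$ is convex if $((1-\lambda)x\oplus\lambda y,(1-\lambda)x^{\lozenge}+\lambda y^{\lozenge})\in C$ for all $(x,x^{\lozenge}),(y,y^{\lozenge})\in C$, $\lambda\in[0,1]$. A function $h:X\times X^{\lozenge}\to[-\infty,\infty]$ is convex if $h((1-\lambda)x\oplus\lambda y,(1-\lambda)x^{\lozenge}+\lambda y^{\lozenge})\le(1-\lambda)h(x,x^{\lozenge})+\lambda h(y,y^{\lozenge})$ for all $(x,x^{\lozenge}),(y,y^{\lozenge})\in X\times X^{\lozenge}$, $\lambda\in[0,1]$. Conventions: $0\cdot(\pm\infty)=0$, $\infty+(-\infty)=\infty$, $\sup\emptyset=-\infty$. The indicator $\iota_C$ equals $0$ on $C$ and $\infty$ off $C$. For a set-valued operator $T:X\multimap X^{\lozenge}$ (a map assigning to each $x\in X$ a possibly empty subset $T(x)\subseteq X^{\lozenge}$), $\mathrm{gra}(T)=\{(x,x^{\lozenge}):x^{\lozenge}\in T(x)\}$ and $\mathrm{Range}(T)=\mathrm{Range}(\mathrm{gra}(T))$.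 Its $p$-Fitzpatrick transform is $\Phi^p_T:X\times X^{\lozenge}\to[-\infty,\infty]$, $$\Phi^p_T(x,x^{\lozenge})=\sup_{(y,y^{\lozenge})\in\mathrm{gra}(T)}\{\langle x^{\lozenge},\overrightarrow{py}\rangle-\langle y^{\lozenge},\overrightarrow{xy}\rangle\}.$$ *)

(* Defs.v *)
From HB Require Import structures.
From mathcomp Require Import all_boot all_order all_algebra.
From mathcomp Require Import all_classical all_reals all_analysis.
From mathcomp Require Import ring lra.

Set Implicit Arguments.
Unset Strict Implicit.
Unset Printing Implicit Defensive.

Import Order.TTheory GRing.Theory Num.Theory.

Local Open Scope classical_set_scope.
Local Open Scope ring_scope.

Section Geodesics.
Context {R : realType} {X : metricType R}.
Implicit Types (x y z : X) (c : R -> X) (a b : 'rV[R]_2).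

(* Only the values of c on [0, 1] matter. *)
Definition is_geodesic x y c : Prop :=
  [/\ c 0 = x, c 1 = y &
      forall s t : R, 0 <= s <= 1 -> 0 <= t <= 1 ->
        mdist (c s) (c t) = `|s - t| * mdist x y].

(* The point (1 - t) x (+) t y is geod x y t, for t in [0, 1]. *)
Definition geod x y : R -> X := xget (fun=> x) [set c | is_geodesic x y c].

(* The library norm on 'rV[R]_2 is the sup norm, hence this definition. *)
Definition edist a b : R := Num.sqrt (\sum_i (a 0 i - b 0 i) ^+ 2).

End Geodesics.

Section CAT0.
Context {R : realType} (X : metricType R).

(* Triangle comparison with the Euclidean plane. Two points on distinct sides
   of a geodesic triangle may be taken, up to renaming the vertices, on the two
   sides issued from x; the third side exists by the first conjunct. *)
Definition CAT0 : Prop :=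
  (forall x y : X, exists c : R -> X, is_geodesic x y c) /\
  (forall (x y z : X) (c c' : R -> X) (x' y' z' : 'rV[R]_2),
     is_geodesic x y c -> is_geodesic x z c' ->
     edist x' y' = mdist x y -> edist x' z' = mdist x z ->
     edist y' z' = mdist y z ->
     forall s t : R, 0 <= s <= 1 -> 0 <= t <= 1 ->
       mdist (c s) (c' t) <=
       edist ((1 - s) *: x' + s *: y') ((1 - t) *: x' + t *: z')).

End CAT0.

HB.mixin Record Metric_isCAT0 (R : realType) X & Metric R X := {
  cat0_subproof : CAT0 X
}.

#[short(type="hadamardType")]
HB.structure Definition Hadamard (R : realType) :=
  { X of Complete X & Metric R X & Metric_isCAT0 R X }.

Section GeodesicTheory.
Context {R : realType} {X : hadamardType R}.
Implicit Types (x y : X).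

Lemma geod_is_geodesic x y : is_geodesic x y (geod x y).
Proof.
have [+ _] := @cat0_subproof R X => /(_ x y) [c cP].
by rewrite /geod; case: xgetP => [d _ //|/(_ c)]; case.
Qed.

Lemma geodesic_unique x y (c c' : R -> X) (t : R) :
  is_geodesic x y c -> is_geodesic x y c' -> 0 <= t <= 1 -> c t = c' t.
Proof.
move=> cP c'P t01; have [_ cat] := @cat0_subproof R X.
pose y' : 'rV[R]_2 := \row_i ((i == 0)%:R * mdist x y).
have d0y : edist 0 y' = mdist x y.
  rewrite /edist big_ord_recl big_ord1 !mxE/= mul1r mul0r !sub0r oppr0.
  by rewrite expr0n addr0 sqrrN sqrtr_sqr ger0_norm ?mdist_ge0.
have eqq (a : 'rV[R]_2) : edist a a = 0.
  by rewrite /edist big1 ?sqrtr0// => i _; rewrite subrr expr0n.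
have := cat x y y c c' 0 y' y' cP c'P d0y d0y.
rewrite eqq mdistxx => /(_ erefl t t t01 t01); rewrite eqq => le0.
by apply: (@mdist_positivity R); apply/eqP; rewrite eq_le le0 mdist_ge0.
Qed.

End GeodesicTheory.

Definition flat (R : realType) (X : hadamardType R) : Prop :=
  forall (x y z : X) (t : R), 0 <= t <= 1 ->
    mdist z (geod x y t) ^+ 2 =
    (1 - t) * mdist z x ^+ 2 + t * mdist z y ^+ 2
    - t * (1 - t) * mdist x y ^+ 2.

Section LinearDual.
Context {R : realType} (X : hadamardType R).

Definition qlin (x y u v : X) : R :=
  2^-1 * (mdist x v ^+ 2 + mdist y u ^+ 2 - mdist x u ^+ 2 - mdist y v ^+ 2).

(* The class [t ab], identified with its action; the pair (x, y) stands for
   the bound vector from x to y. *)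
Definition dual_elt (t : R) (a b : X) : X * X -> R^o :=
  fun xy => t * qlin a b xy.1 xy.2.

Definition dual : set (X * X -> R^o) :=
  [set f | exists t a b, f = dual_elt t a b].

Definition dual_span : set (X * X -> R^o) :=
  [set f | exists n (alpha : 'I_n -> R) (u : 'I_n -> (X * X -> R^o)),
     (forall i, dual (u i)) /\ f = \sum_i alpha i *: u i].

Definition dual_span_pred : {pred X * X -> R^o} := [pred f | f \in dual_span].

Lemma dual_span_submod : submod_closed dual_span_pred.
Proof.
split=> [|a f g].
  rewrite inE; exists 0, (fun=> 0), (fun=> 0); split; first by case.
  by rewrite big_ord0.
rewrite !inE => -[n [al [u [ud ->]]]] [m [be [v [vd ->]]]].
exists (n + m)%N.
exists (fun i : 'I_(n + m) =>
  match fintype.split i with inl j => a * al j | inr k => be k end).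
exists (fun i : 'I_(n + m) =>
  match fintype.split i with inl j => u j | inr k => v k end).
split; first by move=> i; case: (fintype.split i).
rewrite big_split_ord/= scaler_sumr; congr (_ + _); apply: eq_bigr => i _.
  by have /= -> := unsplitK (inl i : 'I_n + 'I_m); rewrite scalerA.
by have /= -> := unsplitK (inr i : 'I_n + 'I_m).
Qed.

HB.instance Definition _ :=
  GRing.isSubmodClosed.Build R (X * X -> R^o) dual_span_pred dual_span_submod.

Record lin_dual := LinDual {
  act : X * X -> R^o;
  _ : act \in dual_span_pred
}.

HB.instance Definition _ := [isSub for act].
HB.instance Definition _ := [Choice of lin_dual by <:].
HB.instance Definition _ := [SubChoice_isSubLmodule of lin_dual by <:].

Definition pairing (xd : lin_dual) (x y : X) : R := act xd (x, y).

Lemma pairingDZ (a b : R) (xd yd : lin_dual) (x y : X) :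
  pairing (a *: xd + b *: yd) x y = a * pairing xd x y + b * pairing yd x y.
Proof. by []. Qed.

Lemma pairing_chasles (xd : lin_dual) (p q x : X) :
  pairing xd p x = pairing xd p q + pairing xd q x.
Proof.
case: xd => f fP; rewrite /pairing /=; move: fP.
rewrite inE => -[n [al [u [ud ->]]]].
rewrite !fct_sumE -big_split/=; apply: eq_bigr => i _.
have [t [a [b ->]]] := ud i.
rewrite /dual_elt /GRing.scale/= /qlin -mulrDr; congr (_ * _).
by rewrite -mulrDr; congr (_ * _); rewrite -mulrDr; congr (_ * _); ring.
Qed.

End LinearDual.

Arguments pairing : simpl never.

Section Operators.
Context {R : realType} {X : hadamardType R}.
Implicit Types (M C : set (X * lin_dual X)) (T : X -> set (lin_dual X)).
Implicit Types (h : X * lin_dual X -> \bar R).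

Definition Dom M : set X := fst @` M.

Definition Range M : set (lin_dual X) := snd @` M.

Definition Fl_at (p : X) M : Prop :=
  forall (l : R) (xd : lin_dual X) (x y : X),
    0 <= l <= 1 -> Range M xd -> Dom M x -> Dom M y ->
    pairing xd p (geod x y l) <= (1 - l) * pairing xd p x + l * pairing xd p y.

Definition Fl_property M : Prop := forall p : X, Fl_at p M.

Lemma Fl_property_at (p : X) M : Fl_property M <-> Fl_at p M.
Proof.
split=> [|H q l xd x y l01 xdM xM yM]; first exact.
have := H l xd x y l01 xdM xM yM.
rewrite (pairing_chasles xd q p (geod _ _ _)) (pairing_chasles xd q p x).
rewrite (pairing_chasles xd q p y) => Hp.
by rewrite !mulrDr addrACA -mulrDl subrK mul1r lerD2l.
Qed.

Definition convex_subset C : Prop :=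
  forall z w, C z -> C w -> forall l : R, 0 <= l <= 1 ->
    C (geod z.1 w.1 l, (1 - l) *: z.2 + l *: w.2).

(* Extended-real sums are dual sums (scope %dE), for which oo + (-oo) = oo. *)
Definition convex_fun h : Prop :=
  forall z w, forall l : R, 0 <= l <= 1 ->
    (h (geod z.1 w.1 l, ((1 - l) *: z.2 + l *: w.2)%R) <=
     (1 - l)%:E * h z + l%:E * h w)%dE.

Definition indicator C : X * lin_dual X -> \bar R :=
  fun z => if z \in C then 0%E else +oo%E.

Definition gra T : set (X * lin_dual X) := [set z | T z.1 z.2].

Definition fitzpatrick (p : X) T : X * lin_dual X -> \bar R :=
  fun z => ereal_sup
    [set (pairing z.2 p w.1 - pairing w.2 z.1 w.1)%:E | w in gra T].

End Operators.

(* Main.v *)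
Require Import Defs.
From mathcomp Require Import all_boot all_order all_algebra.
From mathcomp Require Import all_classical all_reals all_analysis.
From mathcomp Require Import ring lra.

Import Order.TTheory GRing.Theory Num.Theory.
Import DualAddTheory.
Local Open Scope classical_set_scope.
Local Open Scope ring_scope.

(** For a fixed [(y, yd)] in the graph of [T], the function under the supremum is linear in the dual
    variable and depends on the point [x] only through [pairing yd y x], which the F_l-property
    makes convex along the geodesic. Taking the supremum over the graph preserves the inequality:
    this is [fitzpatrick_geod_le], part (i), to which the other parts reduce. For (ii) and (iii),
    [Fl_property_sub] passes the F_l-property down to the two endpoints. In (ii),
    [convex_fun_indicator] disposes of endpoints off [C], where dual addition gives [+oo] even if
    the transform is [-oo]. For (iv), pairings in a flat space are affine along geodesics, so every
    set has the F_l-property. *)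

Section Pairing.
Context {R : realType} {X : hadamardType R}.
Implicit Types (p x y : X) (xd : lin_dual X) (M N : set (X * lin_dual X)).

Lemma geod0 x y : geod x y 0 = x.
Proof. by have [] := geod_is_geodesic x y. Qed.

Lemma geod1 x y : geod x y 1 = y.
Proof. by have [] := geod_is_geodesic x y. Qed.

Lemma pairing_opp xd x y : pairing xd x y = - pairing xd y x.
Proof.
have xx z : pairing xd z z = 0.
  by apply: (addrI (pairing xd z z)); rewrite -pairing_chasles addr0.
by apply/eqP; rewrite -addr_eq0 -pairing_chasles xx.
Qed.

(** The moving point enters [qlin] through two squared distances of opposite sign, so the quadratic
    corrections of the flatness identity cancel. *)
Lemma flat_qlin_geod (a b p x y : X) (l : R) : flat X -> 0 <= l <= 1 ->
  qlin a b p (geod x y l) = (1 - l) * qlin a b p x + l * qlin a b p y.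
Proof. by move=> flatX l01; rewrite /qlin !(flatX _ _ _ _ l01); ring. Qed.

Lemma flat_pairing_geod xd p x y (l : R) : flat X -> 0 <= l <= 1 ->
  pairing xd p (geod x y l) = (1 - l) * pairing xd p x + l * pairing xd p y.
Proof.
move=> flatX l01; case: xd => f fP; rewrite /pairing /=; move: fP.
rewrite inE => -[n [al [u [ud ->]]]].
rewrite !fct_sumE !mulr_sumr -big_split/=; apply: eq_bigr => i _.
have [t [a [b ->]]] := ud i.
(* Scaling in the module [R^o] is multiplication in [R]; stated so that ring lemmas can rewrite
   it. *)
have alE (r : R^o) : al i *: r = al i * (r : R) by [].
rewrite /dual_elt /GRing.scale/= flat_qlin_geod// !alE.
by rewrite !mulrDr !(mulrCA (al i)) !(mulrCA t).
Qed.

Lemma flat_Fl_property M : flat X -> Fl_property M.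
Proof. by move=> flatX p l xd x y l01 _ _ _; rewrite flat_pairing_geod. Qed.

Lemma Fl_property_sub M N : Dom M `<=` Dom N -> Range M `<=` Range N ->
  Fl_property N -> Fl_property M.
Proof.
by move=> DMN RMN FN p l xd x y l01 /RMN ? /DMN ? /DMN ?; exact: FN.
Qed.

End Pairing.

Section Fitzpatrick.
Context {R : realType} {X : hadamardType R}.
Implicit Types (p : X) (T : X -> set (lin_dual X)) (C : set (X * lin_dual X)).

(* Each function in the supremum is a pairing with the dual variable minus
   <y*, xy>, which is convex along the geodesic by the F_l-property based at
   y. *)
Lemma fitzpatrick_geod_le p T (a b : X) (ad bd : lin_dual X) (l : R) :
  Fl_property ([set a; b] `*` Range (gra T)) -> 0 <= l <= 1 ->
  (fitzpatrick p T (geod a b l, ((1 - l) *: ad + l *: bd)%R) <=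
   (1 - l)%:E * fitzpatrick p T (a, ad) + l%:E * fitzpatrick p T (b, bd))%dE.
Proof.
move=> FlT l01; apply: ge_ereal_sup => _ [[y yd] Tyd <-] /=.
have /andP[l0 l1] := l01.
have Ryd : Range (gra T) yd by exists (y, yd).
have le_sup x xd : ((pairing xd p y - pairing yd x y)%:E <=
    fitzpatrick p T (x, xd))%E by apply: ereal_sup_ubound; exists (y, yd).
have FlE : pairing yd y (geod a b l) <=
    (1 - l) * pairing yd y a + l * pairing yd y b.
  apply: FlT => //.
  - by exists (a, yd) => //; split => //; left.
  - by exists (a, yd) => //; split => //; left.
  - by exists (b, yd) => //; split => //; right.
have le1 : ((1 - l)%:E * (pairing ad p y - pairing yd a y)%:E <=
    (1 - l)%:E * fitzpatrick p T (a, ad))%E.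
  by apply: lee_wpmul2l; rewrite ?lee_fin ?subr_ge0.
have le2 : (l%:E * (pairing bd p y - pairing yd b y)%:E <=
    l%:E * fitzpatrick p T (b, bd))%E.
  by apply: lee_wpmul2l; rewrite ?lee_fin.
(* Both suprema on the right are replaced by their terms at the same [(y, yd)], which leaves an
   inequality between real numbers. *)
apply: le_trans (lee_dD le1 le2).
rewrite -!EFinM -dEFinD lee_fin pairingDZ.
(* Reversing the vectors bases all pairings with [yd] at [y], as in [FlE]. *)
rewrite (pairing_opp yd _ y) (pairing_opp yd a y) (pairing_opp yd b y).
lra.
Qed.

Lemma convex_fun_fitzpatrick p T :
  Fl_property ([set: X] `*` Range (gra T)) -> convex_fun (fitzpatrick p T).
Proof.
move=> FlT [a ad] [b bd] l l01; apply: fitzpatrick_geod_le => //.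
by apply: Fl_property_sub FlT; apply: image_subset; exact: setSX.
Qed.

(* For [0 < l < 1] the right-hand side is infinite as soon as an endpoint is
   off [C]; for [l = 0, 1] the infinite endpoint is cancelled by [0 * oo = 0],
   and both sides agree. *)
Lemma convex_fun_indicator (h : X * lin_dual X -> \bar R) C :
  convex_subset C ->
  (forall z w, C z -> C w -> forall l : R, 0 <= l <= 1 ->
    (h (geod z.1 w.1 l, ((1 - l) *: z.2 + l *: w.2)%R) <=
     (1 - l)%:E * h z + l%:E * h w)%dE) ->
  convex_fun (fun z => (h z + indicator C z)%dE).
Proof.
move=> cC hC z w l l01.
have [->|l_neq0] := eqVneq l 0.
  rewrite geod0 subr0 scale1r scale0r addr0 mul1e mul0e dadde0.
  by case: z => ? ? /=.
have [->|l_neq1] := eqVneq l 1.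
  rewrite geod1 subrr scale1r scale0r add0r mul1e mul0e dadd0e.
  by case: w => ? ? /=.
have /andP[l0 l1] := l01.
have gt0 : (0 < l%:E)%E by rewrite lte_fin lt0r l_neq0.
have gt0' : (0 < (1 - l)%:E)%E by rewrite lte_fin subr_gt0 lt_neqAle l_neq1.
have [Cz|Cz] := boolP (z \in C); last first.
  by rewrite {2}/indicator (negbTE Cz) daddey gt0_muley// daddye leey.
have [Cw|Cw] := boolP (w \in C); last first.
  by rewrite {3}/indicator (negbTE Cw) daddey gt0_muley// daddey leey.
have Cg : (geod z.1 w.1 l, (1 - l) *: z.2 + l *: w.2) \in C.
  by rewrite inE; apply: cC => //; exact: set_mem.
by rewrite /indicator Cz Cw Cg !dadde0; apply: hC => //; exact: set_mem.
Qed.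

End Fitzpatrick.

Theorem proposition5p8 (R : realType) (X : hadamardType R) (p : X)
    (T : X -> set (lin_dual X)) :
  (forall a b : X,
     Fl_property ([set a; b] `*` Range (gra T)) ->
     forall (ad bd : lin_dual X) (l : R), 0 <= l <= 1 ->
       (fitzpatrick p T (geod a b l, ((1 - l) *: ad + l *: bd)%R) <=
        (1 - l)%:E * fitzpatrick p T (a, ad)
        + l%:E * fitzpatrick p T (b, bd))%dE) /\
  (forall C : set (X * lin_dual X),
     convex_subset C -> Fl_property C -> Range (gra T) `<=` Range C ->
     convex_fun (fun z => (fitzpatrick p T z + indicator C z)%dE)) /\
  (Fl_property ([set: X] `*` Range (gra T)) -> convex_fun (fitzpatrick p T)) /\
  (flat X -> convex_fun (fitzpatrick p T)).
Proof.
split; first by move=> a b FlT ad bd l; exact: fitzpatrick_geod_le.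
split; last first.
  split; first exact: convex_fun_fitzpatrick.
  by move=> flatX; apply: convex_fun_fitzpatrick; exact: flat_Fl_property.
move=> C cC FlC TC; apply: convex_fun_indicator => //.
move=> [a ad] [b bd] Ca Cb l l01; apply: fitzpatrick_geod_le => //.
(* The endpoints [a] and [b] lie in [Dom C], witnessed by [Ca] and [Cb]; the ranges are compared by
   [TC]. *)
apply: Fl_property_sub FlC.
  by move=> _ [[x xd] [/= [->|->] _] <-]; [exists (a, ad)|exists (b, bd)].
by move=> _ [[x xd] [_ Txd] <-]; exact: TC.
Qed.
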